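(* In the rock-paper-scissors game there exist initial strategies $(\boldsymbol{x}_1,\boldsymbol{y}_1)\in\Delta_3\times\Delta_3$ for which the sequence of iterates $(\boldsymbol{x}_t,\boldsymbol{y}_t)_{t\ge 1}$ produced by CFR diverges (i.e. does not converge).
   Context: $\Delta_3=\{\boldsymbol{x}\in\mathbb{R}^3:\ x_j\ge 0,\ x_1+x_2+x_3=1\}$. The rock-paper-scissors game is the zero-sum game $\min_{\boldsymbol{x}\in\Delta_3}\max_{\boldsymbol{y}\in\Delta_3}\boldsymbol{x}^\top \boldsymbol{G}\boldsymbol{y}$ with $$\boldsymbol{G}=\begin{bmatrix}0&-1&1\\1&0&-1\\-1&1&0\end{bmatrix}.$$ In a normal-form game such as this one, CFR (Counterfactual Regret Minimization, with simultaneous updates) means that both players run regret matching: at each time $t\ge 1$ the loss vectors are $\boldsymbol{L}^x_t=\boldsymbol{G}\boldsymbol{y}_t$ and $\boldsymbol{L}^y_t=-\boldsymbol{G}^\top\boldsymbol{x}_t$. For player $\boldsymbol{x}$ put $\mathrm{reg}^x_{t,j}=\langle \boldsymbol{x}_t,\boldsymbol{L}^x_t\rangle-L^x_{t,j}$, $\mathrm{Reg}^x_{0,j}=0$ and $\mathrm{Reg}^x_{t,j}=\mathrm{Reg}^x_{t-1,j}+\mathrm{reg}^x_{t,j}$ for $j=1,2,3$. Then $$x_{t+1,i}=\frac{[\mathrm{Reg}^x_{t,i}]_+}{\sum_{j=1}^3[\mathrm{Reg}^x_{t,j}]_+},\qquad [a]_+=\max(0,a),$$ whenever the denominator is nonzero,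 and $\boldsymbol{x}_{t+1}\in\Delta_3$ is arbitrary otherwise. Player $\boldsymbol{y}$ does the same with $\boldsymbol{y}_t$ and $\boldsymbol{L}^y_t$ in place of $\boldsymbol{x}_t$ and $\boldsymbol{L}^x_t$. *)

(* Defs.v *)
From HB Require Import structures.
From mathcomp Require Import all_boot all_order all_algebra.
From mathcomp Require Import all_classical all_reals all_analysis.

Set Implicit Arguments.
Unset Strict Implicit.
Unset Printing Implicit Defensive.

Import Order.TTheory GRing.Theory Num.Theory.
Import numFieldNormedType.Exports.

Local Open Scope classical_set_scope.
Local Open Scope ring_scope.

Definition simplex (R : realType) (n : nat) : set 'cV[R]_n :=
  [set x | (forall j, 0 <= x j 0) /\ \sum_j x j 0 = 1].

Definition rps (R : realType) : 'M[R]_3 :=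
  \matrix_(i < 3, j < 3)
    nth 0 (nth [::] [:: [:: 0; -1; 1];
                        [:: 1; 0; -1];
                        [:: -1; 1; 0]] i) j.

Definition inst_regret (R : realType) (n : nat) (x L : 'cV[R]_n) : 'cV[R]_n :=
  \col_j ((x^T *m L) 0 0 - L j 0).

(* Sequences of strategies and of losses are indexed by the times t >= 1;
   their value at 0 is never used. *)
Fixpoint cum_regret (R : realType) (n : nat) (x L : nat -> 'cV[R]_n) (t : nat)
    : 'cV[R]_n :=
  if t is s.+1 then cum_regret x L s + inst_regret (x s.+1) (L s.+1) else 0.

(* A relation rather than a function: when no cumulative regret is positive,
   any point of the simplex may be played next. *)
Definition regret_matching (R : realType) (n : nat) (x L : nat -> 'cV[R]_n)
    : Prop :=
  forall t, (1 <= t)%N ->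
    let pos_regret j := Num.max 0 (cum_regret x L t j 0) in
    let total := \sum_j pos_regret j in
    (total <> 0 -> forall i, x t.+1 i 0 = pos_regret i / total) /\
    (total = 0 -> simplex (x t.+1)).

(* x minimizes and y maximizes x^T A y, with simultaneous updates. *)
Definition cfr (R : realType) (m n : nat) (A : 'M[R]_(m, n))
    (x : nat -> 'cV[R]_m) (y : nat -> 'cV[R]_n) : Prop :=
  regret_matching x (fun t => A *m y t) /\
  regret_matching y (fun t => - (A^T *m x t)).

(* Main.v *)
(** Regret matching converges only to best responses, and the only equilibrium
    of rock-paper-scissors is the barycenter.  Let both players start from the
    same vertex.  By antisymmetry of the game they then play alike forever, the
    cumulative regrets sum to zero, and the positive parts of the cumulative
    regrets never vanish simultaneously.  Hence some regret is always
    nonpositive, so every iterate after the first lies on the boundary of the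
    simplex, away from the barycenter. *)
Require Import Defs.
From HB Require Import structures.
From mathcomp Require Import all_boot all_order all_algebra.
From mathcomp Require Import all_classical all_reals all_analysis.
From mathcomp Require Import ring lra.

Set Implicit Arguments.
Unset Strict Implicit.
Unset Printing Implicit Defensive.

Import Order.TTheory GRing.Theory Num.Theory.
Import numFieldNormedType.Exports.

Local Open Scope classical_set_scope.
Local Open Scope ring_scope.

(** * Regret matching against arbitrary losses *)

Definition pos_regret_sum (R : realType) (n : nat) (x L : nat -> 'cV[R]_n)
    (t : nat) : R :=
  \sum_j Num.max 0 (cum_regret x L t j 0).

Lemma dot_cVE (R : realType) (n : nat) (u v : 'cV[R]_n) :
  (u^T *m v) 0 0 = \sum_j u j 0 * v j 0.
Proof. by rewrite mxE; apply: eq_bigr => j _; rewrite mxE. Qed.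

Lemma mul_max0l (R : realDomainType) (a : R) :
  Num.max 0 a * a = Num.max 0 a ^+ 2.
Proof. by case: leP; rewrite ?expr2 ?mul0r. Qed.

Lemma sum_max0_eq0 (R : realDomainType) (I : finType) (F : I -> R) :
  \sum_j Num.max 0 (F j) = 0 -> forall j, Num.max 0 (F j) = 0.
Proof.
move=> /eqP; rewrite psumr_eq0 => [/allP h j|j _]; last by rewrite le_max lexx.
by apply/eqP; rewrite (implyP (h j _)) ?mem_index_enum.
Qed.

(** Each summand is the square of a positive part, so each positive part vanishes. *)
Lemma sum_max0_mul_eq0 (R : realDomainType) (I : finType) (F : I -> R) :
  \sum_j Num.max 0 (F j) * F j = 0 -> forall j, F j <= 0.
Proof.
under eq_bigr do rewrite mul_max0l.
move=> /eqP; rewrite psumr_eq0 => [/allP h j|j _]; last exact: sqr_ge0.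
move: (implyP (h j (mem_index_enum j)) isT).
by rewrite sqrf_eq0 => /eqP <-; rewrite le_max lexx orbT.
Qed.

(** The update rule without division: if the total is zero, both sides vanish, whatever point is
    played. *)
Lemma regret_matching_prod (R : realType) (n : nat) (x L : nat -> 'cV[R]_n)
    (t : nat) (i : 'I_n) : regret_matching x L -> (0 < t)%N ->
  pos_regret_sum x L t * x t.+1 i 0 = Num.max 0 (cum_regret x L t i 0).
Proof.
move=> rm t0; have [xE _] := rm t t0.
have [S0|SN0] := eqVneq (pos_regret_sum x L t) 0.
  by rewrite S0 mul0r (sum_max0_eq0 S0).
by rewrite xE; [rewrite mulrC divfK | apply/eqP].
Qed.

Lemma regret_matching_sum1 (R : realType) (n : nat) (x L : nat -> 'cV[R]_n)
    (t : nat) : regret_matching x L -> (0 < t)%N -> \sum_i x t.+1 i 0 = 1.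
Proof.
move=> rm t0; have [xE xS] := rm t t0.
have [S0|SN0] := eqVneq (pos_regret_sum x L t) 0; first by case: (xS S0).
under eq_bigr do rewrite (xE (elimN eqP SN0)).
by rewrite -mulr_suml divff.
Qed.

(* The instantaneous regret at [t.+1] is orthogonal to [x t.+1], hence to the
   positive part of the cumulative regret at [t], whose inner product with the
   cumulative regret at [t.+1] is therefore its squared norm. *)
Lemma pos_regret_sum_neq0 (R : realType) (n : nat) (x L : nat -> 'cV[R]_n)
    (t : nat) : regret_matching x L -> (0 < t)%N ->
  pos_regret_sum x L t != 0 -> pos_regret_sum x L t.+1 != 0.
Proof.
move=> rm t0; apply: contra_neq => SN0.
pose P j := Num.max 0 (cum_regret x L t j 0).
have PE j : P j = pos_regret_sum x L t * x t.+1 j 0.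
  by rewrite regret_matching_prod.
have P0 j : 0 <= P j by rewrite le_max lexx.
have ortho : \sum_j P j * inst_regret (x t.+1) (L t.+1) j 0 = 0.
  under eq_bigr do rewrite PE mxE -mulrA mulrBr.
  rewrite -mulr_sumr sumrB -mulr_suml (regret_matching_sum1 rm)// mul1r.
  by rewrite dot_cVE subrr mulr0.
have cum_le0 j : cum_regret x L t.+1 j 0 <= 0.
  by rewrite -(sum_max0_eq0 SN0 j) le_max lexx orbT.
rewrite /pos_regret_sum big1// => j _; apply: le_anti; rewrite P0 andbT.
rewrite ge_max lexx /=; move: j; apply: sum_max0_mul_eq0.
apply: le_anti; apply/andP; split; last first.
  by apply: sumr_ge0 => j _; rewrite mul_max0l sqr_ge0.
rewrite -[leLHS]addr0 -[X in _ + X]ortho -big_split /=.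
apply: sumr_le0 => j _.
have := mulr_ge0_le0 (P0 j) (cum_le0 j).
by rewrite /= mxE mulrDr.
Qed.

(** * Limits of averaged regrets *)

Lemma cvg_sumr (R : realType) (I : finType) (u : I -> nat -> R) (l : I -> R) :
  (forall i, u i t @[t --> \oo] --> l i) ->
  \sum_i u i t @[t --> \oo] --> \sum_i l i.
Proof. by move=> ul; apply: cvg_big => //; exact: add_continuous. Qed.

Lemma cvg_max0 (R : realType) (u : nat -> R) (l : R) :
  u t @[t --> \oo] --> l -> Num.max 0 (u t) @[t --> \oo] --> Num.max 0 l.
Proof.
move=> ul; apply: (cvg_comp _ _ ul).
apply: (@continuous_max R R (fun=> 0) id); [exact: cvg_cst|exact: cvg_id].
Qed.

Lemma cum_regret_series (R : realType) (n : nat) (x L : nat -> 'cV[R]_n)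
    (t : nat) (j : 'I_n) :
  cum_regret x L t j 0 =
    series (fun s => inst_regret (x s.+1) (L s.+1) j 0) t.
Proof.
rewrite /series /=; elim: t => [|t IH]; first by rewrite big_geq// mxE.
by rewrite big_nat_recr//= -IH mxE.
Qed.

(** Instantaneous regrets converge by continuity, hence so do their Cesaro means. *)
Lemma cvg_avg_regret (R : realType) (n : nat) (x L : nat -> 'cV[R]_n)
    (l m : 'cV[R]_n) (j : 'I_n) :
  (forall i, x t i 0 @[t --> \oo] --> l i 0) ->
  (forall i, L t i 0 @[t --> \oo] --> m i 0) ->
  t.+1%:R^-1 * cum_regret x L t.+1 j 0 @[t --> \oo] --> inst_regret l m j 0.
Proof.
move=> xl Lm; under eq_cvg do rewrite cum_regret_series.
apply: cesaro.
rewrite (cvg_shiftS (fun t => inst_regret (x t) (L t) j 0)).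
rewrite mxE dot_cVE; under eq_cvg do rewrite mxE dot_cVE.
by apply: cvgB => //; apply: cvg_sumr => i; exact: cvgM.
Qed.

(** Divide the product form of the update rule by the time and pass to the limit: the positive part
    of the limit regret [v] is a multiple of [l]. Since [v] is orthogonal to [l], it has no positive
    entry. *)
Lemma regret_matching_cvg_best_response (R : realType) (n : nat)
    (x L : nat -> 'cV[R]_n) (l m : 'cV[R]_n) :
  regret_matching x L ->
  (forall i, x t i 0 @[t --> \oo] --> l i 0) ->
  (forall i, L t i 0 @[t --> \oo] --> m i 0) ->
  \sum_i l i 0 = 1 /\ forall j, inst_regret l m j 0 <= 0.
Proof.
move=> rm xl Lm.
have x2l i : x t.+2 i 0 @[t --> \oo] --> l i 0.
  by rewrite (cvg_shiftS (fun t => x t.+1 i 0)) (cvg_shiftS (fun t => x t i 0)).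
have l1 : \sum_i l i 0 = 1.
  have := cvg_sumr x2l; under eq_cvg do rewrite (regret_matching_sum1 rm)//.
  by move=> h; exact: (cvg_unique _ h (cvg_cst _)).
split=> //.
pose v j := inst_regret l m j 0; pose s := \sum_j Num.max 0 (v j).
have scale t k : Num.max 0 (t.+1%:R^-1 * cum_regret x L t.+1 k 0) =
    t.+1%:R^-1 * Num.max 0 (cum_regret x L t.+1 k 0).
  by rewrite maxr_pMr ?invr_ge0// mulr0.
have avg i : t.+1%:R^-1 * Num.max 0 (cum_regret x L t.+1 i 0) @[t --> \oo]
    --> Num.max 0 (v i).
  by under eq_cvg do rewrite -scale; apply: cvg_max0; exact: cvg_avg_regret.
have sl i : s * l i 0 = Num.max 0 (v i).
  suff h : t.+1%:R^-1 * Num.max 0 (cum_regret x L t.+1 i 0) @[t --> \oo]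
      --> s * l i 0 by exact: (cvg_unique _ h (avg i)).
  under eq_cvg do rewrite -(regret_matching_prod i rm)// mulrA mulr_sumr.
  by apply: cvgM; [exact: (cvg_sumr avg)|exact: x2l].
apply: sum_max0_mul_eq0.
under eq_bigr do rewrite -sl mxE -mulrA mulrBr.
by rewrite -mulr_sumr sumrB -mulr_suml l1 mul1r dot_cVE subrr mulr0.
Qed.

(** * Rock-paper-scissors and self-play *)

Lemma sum_ord3 (R : realType) (F : 'I_3 -> R) :
  \sum_i F i = F 0 + F 1 + F 2.
Proof.
rewrite !big_ord_recl big_ord0 addr0 addrA.
by congr (_ + F _ + F _); exact: val_inj.
Qed.

Lemma rps_mulE (R : realType) (u : 'cV[R]_3) :
  [/\ (rps R *m u) 0 0 = u 2 0 - u 1 0,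
      (rps R *m u) 1 0 = u 0 0 - u 2 0 &
      (rps R *m u) 2 0 = u 1 0 - u 0 0].
Proof.
by split; rewrite mxE sum_ord3 !mxE /=; ring.
Qed.

Lemma tr_rps (R : realType) : (rps R)^T = - rps R.
Proof.
apply/matrixP => i j; rewrite !mxE.
by case: i j => [[|[|[|i]]] Hi] [[|[|[|j]]] Hj] //=; rewrite ?opprK ?oppr0.
Qed.

(** By antisymmetry, a strategy has value zero against itself. *)
Lemma inst_regret_rps (R : realType) (u : 'cV[R]_3) (j : 'I_3) :
  inst_regret u (rps R *m u) j 0 = - (rps R *m u) j 0.
Proof.
have [e0 e1 e2] := rps_mulE u.
by rewrite mxE dot_cVE sum_ord3 e0 e1 e2; ring.
Qed.

Lemma sum_cum_regret_rps (R : realType) (x : nat -> 'cV[R]_3) (t : nat) :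
  \sum_j cum_regret x (fun t => rps R *m x t) t j 0 = 0.
Proof.
elim: t => [|t IH]; first by rewrite big1// => j _; rewrite mxE.
under eq_bigr do rewrite /= mxE inst_regret_rps.
have [e0 e1 e2] := rps_mulE (x t.+1).
by rewrite big_split /= IH sum_ord3 e0 e1 e2; ring.
Qed.

Lemma eq_cum_regret (R : realType) (n : nat) (x x' L L' : nat -> 'cV[R]_n)
    (t : nat) :
  (forall s, (0 < s <= t)%N -> x s = x' s) ->
  (forall s, (0 < s <= t)%N -> L s = L' s) ->
  cum_regret x L t = cum_regret x' L' t.
Proof.
elim: t => [//|t IH] ex eL /=; rewrite ex ?eL ?leqnn// IH// => s /andP[s0 st].
  by apply: ex; rewrite s0 leqW.
by apply: eL; rewrite s0 leqW.
Qed.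

(** Antisymmetry gives both players the same losses as long as they play alike. The total never
    vanishes, so the update rule is deterministic and no arbitrary choice can separate them. *)
Lemma rps_self_play (R : realType) (x y : nat -> 'cV[R]_3) :
  cfr (rps R) x y -> x 1%N = y 1%N ->
  pos_regret_sum x (fun t => rps R *m y t) 1 != 0 ->
  forall t, (0 < t)%N ->
    y t = x t /\ pos_regret_sum x (fun t => rps R *m y t) t != 0.
Proof.
move=> [rmx rmy] xy1 S1.
have SN0 t : (0 < t)%N -> pos_regret_sum x (fun t => rps R *m y t) t != 0.
  by elim: t => [//|[//|t] IH] _; apply: pos_regret_sum_neq0 => //; exact: IH.
suff yx t s : (0 < s <= t)%N -> y s = x s.
  by move=> t t0; split; [apply: (yx t); rewrite t0 leqnn|exact: SN0].
elim: t s => [[|s]//|t IH] s /andP[s0]; rewrite leq_eqVlt => /predU1P[->|st].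
  case: t IH {s s0} => [_|t IH]; first by rewrite xy1.
  have cumE : cum_regret y (fun t => - ((rps R)^T *m x t)) t.+1 =
      cum_regret x (fun t => rps R *m y t) t.+1.
    apply: eq_cum_regret => s hs; first exact: IH.
    by rewrite tr_rps mulNmx opprK IH.
  have SyN0 : pos_regret_sum y (fun t => - ((rps R)^T *m x t)) t.+1 <> 0.
    by apply/eqP; rewrite /pos_regret_sum cumE; exact: SN0.
  have SxN0 : pos_regret_sum x (fun t => rps R *m y t) t.+1 <> 0.
    exact/eqP/SN0.
  have [/(_ SxN0) xE _] := rmx t.+1 isT.
  have [/(_ SyN0) yE _] := rmy t.+1 isT.
  by apply/colP => i; rewrite xE yE cumE.
by apply: IH; rewrite s0.
Qed.

Lemma simplex_delta (R : realType) (n : nat) (i : 'I_n) :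
  simplex (delta_mx i 0 : 'cV[R]_n).
Proof.
split=> [j|]; first by rewrite mxE ler0n.
rewrite (bigD1 i)//= mxE !eqxx big1 ?addr0// => j ji.
by rewrite mxE (negPf ji).
Qed.

Theorem theorem3 (R : realType) :
  exists x1 y1 : 'cV[R]_3,
    [/\ simplex x1, simplex y1 &
        forall x y : nat -> 'cV[R]_3,
          x 1%N = x1 -> y 1%N = y1 -> cfr (rps R) x y ->
          ~ exists l : 'cV[R]_3 * 'cV[R]_3, (x t, y t) @[t --> \oo] --> l].
Proof.
exists (delta_mx 0 0), (delta_mx 0 0); split; [exact: simplex_delta..|].
move=> x y x1 y1 cfrxy [[l m] /= xyl].
have xl i : x t i 0 @[t --> \oo] --> l i 0.
  have xl : x t @[t --> \oo] --> l by exact: (cvg_comp _ _ xyl cvg_fst).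
  exact: (cvg_comp _ _ xl (@coord_continuous R 3 1 i 0 l)).
pose L t := rps R *m y t.
have S1 : pos_regret_sum x L 1 != 0.
  (* Against the vertex [0], action [2] would have won: its regret after the first round is 1. *)
  apply/eqP => /sum_max0_eq0 /(_ 2).
  have [_ _ e2] := rps_mulE (y 1%N).
  rewrite /= mxE mxE add0r /L -(etrans y1 (esym x1)) inst_regret_rps e2 y1.
  by rewrite !mxE /= sub0r opprK; case: leP; lra.
have sp := rps_self_play cfrxy (etrans x1 (esym y1)) S1.
have LG i : L t i 0 @[t --> \oo] --> (rps R *m l) i 0.
  rewrite mxE.
  have Gx : \sum_j rps R i j * x t j 0 @[t --> \oo] -->
      \sum_j rps R i j * l j 0.
    by apply: cvg_sumr => j; apply: cvgM => //; exact: cvg_cst.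
  (* The players agree only from time 1 on; the values at 0 are unconstrained. *)
  apply: cvg_trans Gx; apply: near_eq_cvg; exists 1%N => // t t0 /=.
  by rewrite /L (sp t t0).1 mxE.
have [l1 br] := regret_matching_cvg_best_response cfrxy.1 xl LG.
have ord3P (i : 'I_3) : [\/ i = 0, i = 1 | i = 2].
  by case: i => [[|[|[|i]]] Hi] //; [apply: Or31|apply: Or32|apply: Or33];
     apply: val_inj.
(* The best-response inequalities form a cycle, l2 >= l1 >= l0 >= l2, so [l] is the barycenter. *)
have lpos i : 0 < l i 0.
  have [e0 e1 e2] := rps_mulE l.
  move: (br 0) (br 1) (br 2) l1; rewrite !inst_regret_rps e0 e1 e2 sum_ord3.
  by have [->|->|->] := ord3P i; lra.
have xpos i : \forall t \near \oo, 0 < x t i 0.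
  exact: (cvgr_gt _ (xl i)).
have [N _ xN] :
    \forall t \near \oo, [/\ 0 < x t 0 0, 0 < x t 1 0 & 0 < x t 2 0].
  by near=> t; split; near: t; exact: xpos.
(* An action played with positive weight at [N.+2] has positive regret at [N.+1], the total there
   being nonzero. *)
have cumpos i : 0 < cum_regret x L N.+1 i 0.
  have xi : 0 < x N.+2 i 0.
    by have [p0 p1 p2] := xN N.+2 (leqW (leqnSn N)); have [->|->|->] := ord3P i.
  have := regret_matching_prod i cfrxy.1 (ltn0Sn N).
  case: leP => // _ /eqP.
  by rewrite mulf_eq0 (negPf (sp N.+1 isT).2) gt_eqF.
have := sum_cum_regret_rps x N.+1.
(* Self-play turns the losses against [x] into those against [y]; three positive regrets cannot then
   sum to zero. *)
rewrite (@eq_cum_regret _ _ x x _ L) => [|//|s /andP[s0 _]]; last first.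
  by rewrite /L (sp s s0).1.
by rewrite sum_ord3; move: (cumpos 0) (cumpos 1) (cumpos 2); lra.
Unshelve. all: by end_near. Qed.
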